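(* Let $H=\mathrm{Homeo}_+([0,1])$ be the group of order-preserving homeomorphisms of $[0,1]$. Then every two-dimensional topological similarity class in $H$ is meager in $H\times H$.
   Context: $H$ carries the topology with basic open sets $U(f;a_1,\dots,a_n;\varepsilon)=\{g\in H: |g(a_i)-f(a_i)|<\varepsilon \text{ for } i=1,\dots,n\}$, for $f\in H$, $a_1,\dots,a_n\in[0,1]$, $\varepsilon>0$; this makes $H$ a Polish group. For a topological group $K$, a pair $(g_1,g_2)\in K^2$ is topologically similar to $(f_1,f_2)\in K^2$ if the map $g_i\mapsto f_i$ ($i=1,2$) extends to a group isomorphism $\langle g_1,g_2\rangle\to\langle f_1,f_2\rangle$ that is a homeomorphism with respect to the subspace topologies. Its equivalence classes are the two-dimensional topological similarity classes. *)

(* Defs.v *)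
From Stdlib Require Import Reals Lra List.
Open Scope R_scope.

(* Elements of H = Homeo_+([0,1]) are represented by functions R -> R that are
   the identity outside [0,1] (a normalization making Leibniz equality of
   functions coincide with equality of homeomorphisms of [0,1]). *)
Definition I01 (x : R) : Prop := 0 <= x <= 1.

Definition in_H (f : R -> R) : Prop :=
  (forall x, ~ I01 x -> f x = x) /\
  (forall x, I01 x -> I01 (f x)) /\
  (forall x y, I01 x -> I01 y -> f x = f y -> x = y) /\
  (forall y, I01 y -> exists x, I01 x /\ f x = y) /\
  (forall x, I01 x -> forall eps, 0 < eps -> exists delta, 0 < delta /\
     forall y, I01 y -> Rabs (y - x) < delta -> Rabs (f y - f x) < eps) /\
  (forall x, I01 x -> forall eps, 0 < eps -> exists delta, 0 < delta /\
     forall y, I01 y -> Rabs (f y - f x) < delta -> Rabs (y - x) < eps) /\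
  (forall x y, I01 x -> I01 y -> x <= y -> f x <= f y).

Definition HSet := (R -> R) -> Prop.

Definition basic (f : R -> R) (l : list R) (eps : R) : HSet :=
  fun g => in_H g /\ forall a, In a l -> Rabs (g a - f a) < eps.

Definition basic_ok (l : list R) (eps : R) : Prop :=
  (forall a, In a l -> I01 a) /\ 0 < eps.

Definition H_open (O : HSet) : Prop :=
  (forall f, O f -> in_H f) /\
  forall f, O f -> exists l eps, basic_ok l eps /\
    forall g, basic f l eps g -> O g.

Definition rel_open (G S : HSet) : Prop :=
  exists O, H_open O /\ forall x, G x -> (S x <-> O x).

Inductive gen (g1 g2 : R -> R) : HSet :=
| gen_id : gen g1 g2 (fun x => x)
| gen_g1 : gen g1 g2 g1
| gen_g2 : gen g1 g2 g2
| gen_comp : forall h k, gen g1 g2 h -> gen g1 g2 k -> gen g1 g2 (fun x => h (k x))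
| gen_inv : forall h k, gen g1 g2 h ->
    (forall x, k (h x) = x) -> (forall x, h (k x) = x) -> gen g1 g2 k.

Definition top_similar (g1 g2 f1 f2 : R -> R) : Prop :=
  exists phi : (R -> R) -> (R -> R),
    let G := gen g1 g2 in let F := gen f1 f2 in
    (forall x, G x -> F (phi x)) /\
    (forall x y, G x -> G y -> phi x = phi y -> x = y) /\
    (forall z, F z -> exists x, G x /\ phi x = z) /\
    (forall x y, G x -> G y -> phi (fun t => x (y t)) = (fun t => phi x (phi y t))) /\
    phi g1 = f1 /\ phi g2 = f2 /\
    (forall O, H_open O -> rel_open G (fun x => O (phi x))) /\
    (forall O, H_open O -> rel_open F (fun z => exists x, G x /\ O x /\ phi x = z)).

Definition H2Set := (R -> R) -> (R -> R) -> Prop.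

Definition H2_open (O : H2Set) : Prop :=
  (forall a b, O a b -> in_H a /\ in_H b) /\
  forall a b, O a b -> exists l1 e1 l2 e2, basic_ok l1 e1 /\ basic_ok l2 e2 /\
    forall c d, basic a l1 e1 c -> basic b l2 e2 d -> O c d.

Definition H2_closure (A : H2Set) : H2Set :=
  fun a b => in_H a /\ in_H b /\
    forall O, H2_open O -> O a b -> exists c d, O c d /\ A c d.

Definition H2_nowhere_dense (A : H2Set) : Prop :=
  ~ exists O, H2_open O /\ (exists a b, O a b) /\
      (forall a b, O a b -> H2_closure A a b).

Definition H2_meager (A : H2Set) : Prop :=
  exists An : nat -> H2Set, (forall n, H2_nowhere_dense (An n)) /\
    forall a b, A a b -> exists n, An n a b.

Definition sim_class (f1 f2 : R -> R) : H2Set :=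
  fun g1 g2 => in_H g1 /\ in_H g2 /\ top_similar g1 g2 f1 f2.

(* Main.v *)
Require Import Defs.
From Stdlib Require Import Reals Lra Lia List Classical ClassicalEpsilon.
From Stdlib Require Import FunctionalExtensionality.
Import ListNotations.

(** Let f = (f1, f2).  Two cases.

    Suppose every neighbourhood of the identity contains w(f) for some nonempty
    reduced word w.  If g is similar to f, there is a neighbourhood U of the
    identity, taken from a countable base, such that |w(g)(1/2) - 1/2| < 1/4
    whenever w(f) is in U.  For fixed U the set of such g is nowhere dense: a
    basic open set contains a pair g without common fixed points in (0,1), so
    some word u pushes 1/2 beyond all the points constrained by the open set.
    If w(f) is close enough to the identity, then the conjugate of w by u
    evaluates at f to an element of U, and g can be redefined near 1 so that
    every letter of this conjugate after u moves the current point further up: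
    the values needed are prescribed one letter at a time, and reducedness is
    exactly what prevents conflicts.

    Otherwise the words w(f), and hence the words w(g) for g similar to f, avoid
    some neighbourhood of the identity.  For a fixed neighbourhood the set of
    such g is nowhere dense, because pairs satisfying a nontrivial relation are
    dense: if g1 = g2 near 0 and near 1 and g has no common fixed point in (0,1),
    then g1^-1 g2 commutes with one of its conjugates. *)

(** * Increasing bijections of the line *)

Definition incbij (f : R -> R) : Prop :=
  (forall x y, x < y -> f x < f y) /\ (forall y, exists x, f x = y).

Lemma not_I01 x : ~ I01 x <-> x < 0 \/ 1 < x.
Proof. unfold I01; lra. Qed.

Lemma I01_cases x : x < 0 \/ I01 x \/ 1 < x.
Proof. unfold I01; lra. Qed.

Lemma incbij_le f x y : incbij f -> x <= y -> f x <= f y.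
Proof. intros [H _] [h | ->]; [apply H in h|]; lra. Qed.

Lemma incbij_lt_inv f x y : incbij f -> f x < f y -> x < y.
Proof.
  intros Hf h. destruct (Rlt_or_le x y) as [|h']; auto.
  apply (incbij_le f) in h'; auto; lra.
Qed.

Lemma incbij_le_inv f x y : incbij f -> f x <= f y -> x <= y.
Proof.
  intros Hf h. destruct (Rle_or_lt x y) as [|h']; auto.
  apply (proj1 Hf) in h'; lra.
Qed.

Lemma incbij_inj f x y : incbij f -> f x = f y -> x = y.
Proof. intros Hf h; apply Rle_antisym; apply (incbij_le_inv f); auto; lra. Qed.

Lemma incbij_continuous f x eps : incbij f -> 0 < eps ->
  exists delta, 0 < delta /\
    forall y, Rabs (y - x) < delta -> Rabs (f y - f x) < eps.
Proof.
  intros Hf He.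
  destruct (proj2 Hf (f x - eps)) as [p Hp].
  destruct (proj2 Hf (f x + eps)) as [q Hq].
  assert (p < x) by (apply (incbij_lt_inv f); auto; lra).
  assert (x < q) by (apply (incbij_lt_inv f); auto; lra).
  exists (Rmin (x - p) (q - x)); split; [apply Rmin_pos; lra|].
  intros y Hy. apply Rabs_def2 in Hy.
  pose proof (Rmin_l (x - p) (q - x)); pose proof (Rmin_r (x - p) (q - x)).
  assert (f p < f y) by (apply Hf; lra).
  assert (f y < f q) by (apply Hf; lra).
  apply Rabs_def1; lra.
Qed.

Lemma in_H_incbij f : in_H f -> incbij f.
Proof.
  intros (Hid & HI & Hinj & Hsurj & _ & _ & Hle); split.
  - intros x y Hxy.
    destruct (I01_cases x) as [hx|[hx|hx]]; destruct (I01_cases y) as [hy|[hy|hy]];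
      try (unfold I01 in *; lra);
      try (rewrite (Hid x) by (apply not_I01; lra));
      try (rewrite (Hid y) by (apply not_I01; lra));
      try (pose proof (HI x hx)); try (pose proof (HI y hy));
      try (unfold I01 in *; lra).
    destruct (Hle x y) as [h|h]; auto; try lra.
    apply Hinj in h; auto; lra.
  - intros y. destruct (classic (I01 y)) as [h|h].
    + destruct (Hsurj y h) as [x [_ Hx]]; eauto.
    + exists y; auto.
Qed.

Lemma in_H_off f x : in_H f -> ~ I01 x -> f x = x.
Proof. intros (H & _); auto. Qed.

Lemma incbij_off_0 f : incbij f -> (forall x, ~ I01 x -> f x = x) -> f 0 = 0.
Proof.
  intros Hf Hid. destruct (proj2 Hf 0) as [x Hx].
  destruct (I01_cases x) as [h|[h|h]];
    try (rewrite Hid in Hx by (apply not_I01; lra); lra).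
  assert (f 0 <= f x) by (apply incbij_le; auto; apply h).
  destruct (Rlt_or_le (f 0) 0) as [h0|]; try lra.
  assert (Hh : f (f 0 / 2) = f 0 / 2) by (apply Hid, not_I01; lra).
  assert (f (f 0 / 2) < f 0) by (apply Hf; lra). lra.
Qed.

Lemma incbij_off_1 f : incbij f -> (forall x, ~ I01 x -> f x = x) -> f 1 = 1.
Proof.
  intros Hf Hid. destruct (proj2 Hf 1) as [x Hx].
  destruct (I01_cases x) as [h|[h|h]];
    try (rewrite Hid in Hx by (apply not_I01; lra); lra).
  assert (f x <= f 1) by (apply incbij_le; auto; apply h).
  destruct (Rlt_or_le 1 (f 1)) as [h0|]; try lra.
  assert (Hh : f ((1 + f 1) / 2) = (1 + f 1) / 2) by (apply Hid, not_I01; lra).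
  assert (f 1 < f ((1 + f 1) / 2)) by (apply Hf; lra). lra.
Qed.

Lemma in_H_0 f : in_H f -> f 0 = 0.
Proof. intros H; apply incbij_off_0; [apply in_H_incbij|apply H]; auto. Qed.

Lemma in_H_1 f : in_H f -> f 1 = 1.
Proof. intros H; apply incbij_off_1; [apply in_H_incbij|apply H]; auto. Qed.

(** Continuity of [f] and of its inverse comes for free from monotonicity and surjectivity, so every
    later construction only has to be an increasing bijection that is the identity off [0,1]. *)
Lemma incbij_in_H f : incbij f -> (forall x, ~ I01 x -> f x = x) -> in_H f.
Proof.
  intros Hf Hid.
  pose proof (incbij_off_0 f Hf Hid) as H0. pose proof (incbij_off_1 f Hf Hid) as H1.
  repeat split; auto.
  - assert (f 0 <= f x) by (apply incbij_le; auto; apply H). lra.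
  - assert (f x <= f 1) by (apply incbij_le; auto; apply H). lra.
  - intros x y _ _; apply incbij_inj; auto.
  - intros y [h0 h1]. destruct (proj2 Hf y) as [x Hx]; exists x; repeat split; auto;
      apply (incbij_le_inv f); auto; lra.
  - intros x _ eps He. destruct (incbij_continuous f x eps Hf He) as [d [Hd H]].
    exists d; split; auto.
  - intros x _ eps He.
    assert (f (x - eps) < f x) by (apply Hf; lra).
    assert (f x < f (x + eps)) by (apply Hf; lra).
    exists (Rmin (f x - f (x - eps)) (f (x + eps) - f x)).
    split; [apply Rmin_pos; lra|]. intros y _ Hy. apply Rabs_def2 in Hy.
    pose proof (Rmin_l (f x - f (x - eps)) (f (x + eps) - f x)).
    pose proof (Rmin_r (f x - f (x - eps)) (f (x + eps) - f x)).
    apply Rabs_def1.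
    + assert (y < x + eps); [|lra]. apply (incbij_lt_inv f); auto; lra.
    + assert (x - eps < y); [|lra]. apply (incbij_lt_inv f); auto; lra.
  - intros x y _ _; apply incbij_le; auto.
Qed.

Lemma incbij_id : incbij (fun x => x).
Proof. split; eauto. Qed.

Lemma in_H_id : in_H (fun x => x).
Proof. apply incbij_in_H; auto using incbij_id. Qed.

Lemma incbij_comp f g : incbij f -> incbij g -> incbij (fun x => f (g x)).
Proof.
  intros [Hf Hf'] [Hg Hg']; split; auto.
  intros y. destruct (Hf' y) as [z Hz]; destruct (Hg' z) as [x Hx].
  exists x; congruence.
Qed.

Lemma in_H_comp f g : in_H f -> in_H g -> in_H (fun x => f (g x)).
Proof.
  intros Hf Hg; apply incbij_in_H; [apply incbij_comp; apply in_H_incbij; auto|].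
  intros x Hx. rewrite (in_H_off g) by auto. apply in_H_off; auto.
Qed.

Lemma in_H_inverse f k : in_H f ->
  (forall x, k (f x) = x) -> (forall x, f (k x) = x) -> in_H k.
Proof.
  intros Hf H1 H2; apply incbij_in_H; [split|].
  - intros x y Hxy. apply (incbij_lt_inv f); [apply in_H_incbij; auto|].
    rewrite !H2; auto.
  - intros y; exists (f y); auto.
  - intros x Hx. rewrite <- (in_H_off f x) at 1 by auto. auto.
Qed.

(** A choice operator is used because surjectivity in [in_H] is only an existence statement, while
    inverse letters must act as functions. *)
Definition hinv (f : R -> R) (y : R) : R := epsilon (inhabits 0) (fun x => f x = y).

Lemma hinvK f y : incbij f -> f (hinv f y) = y.
Proof. intros [_ H]; unfold hinv; apply epsilon_spec; auto. Qed.

Lemma Khinv f x : incbij f -> hinv f (f x) = x.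
Proof. intros H. apply (incbij_inj f); auto. apply hinvK; auto. Qed.

Lemma in_H_hinv f : in_H f -> in_H (hinv f).
Proof.
  intros H; pose proof (in_H_incbij f H).
  apply (in_H_inverse f); auto using hinvK, Khinv.
Qed.

(** * Piecewise linear constructions *)

Definition glue (c : R) (f g : R -> R) (x : R) : R := if Rle_dec x c then f x else g x.

Lemma glue_le c f g x : x <= c -> glue c f g x = f x.
Proof. intros; unfold glue; destruct (Rle_dec x c); lra. Qed.

Lemma glue_gt c f g x : c < x -> glue c f g x = g x.
Proof. intros; unfold glue; destruct (Rle_dec x c); lra. Qed.

Lemma glue_ge c f g x : f c = g c -> c <= x -> glue c f g x = g x.
Proof. intros h [h'| <-]; [apply glue_gt|rewrite glue_le]; auto; lra. Qed.

Lemma incbij_glue c f g : incbij f -> incbij g -> f c = g c -> incbij (glue c f g).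
Proof.
  intros Hf Hg E; split.
  - intros x y Hxy. destruct (Rle_or_lt y c).
    + rewrite !glue_le by lra. apply Hf; auto.
    + rewrite (glue_gt c f g y) by auto. destruct (Rle_or_lt x c).
      * rewrite glue_le by lra. assert (f x <= f c) by (apply incbij_le; auto).
        assert (g c < g y) by (apply Hg; auto). lra.
      * rewrite glue_gt by auto. apply Hg; auto.
  - intros y. destruct (Rle_or_lt y (f c)) as [h|h].
    + destruct (proj2 Hf y) as [x Hx]. exists x. rewrite glue_le; auto.
      apply (incbij_le_inv f); auto; lra.
    + destruct (proj2 Hg y) as [x Hx]. exists x. rewrite glue_gt; auto.
      apply (incbij_lt_inv g); auto; lra.
Qed.

Definition line (p q p' q' x : R) : R := q + (x - p) * ((q' - q) / (p' - p)).

Lemma line_l p q p' q' : line p q p' q' p = q.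
Proof. unfold line; lra. Qed.

Lemma line_r p q p' q' : p < p' -> line p q p' q' p' = q'.
Proof. intros; unfold line; field; lra. Qed.

Lemma incbij_line p q p' q' : p < p' -> q < q' -> incbij (line p q p' q').
Proof.
  intros Hp Hq. assert (Hs : 0 < (q' - q) / (p' - p)) by (apply Rdiv_lt_0_compat; lra).
  unfold line; set (s := (q' - q) / (p' - p)) in *; split.
  - intros x y Hxy. assert (x * s < y * s) by (apply Rmult_lt_compat_r; auto). lra.
  - intros y. exists (p + (y - q) / s). field; lra.
Qed.

(** Keep [g] up to [c], then join (c, g c) to (s, t) and (s, t) to (1, 1) by segments. This
    prescribes one new value without disturbing what is already fixed below [c]. *)
Lemma extend_above g c s t : in_H g -> c < s -> s < 1 -> g c < t -> t < 1 ->
  0 <= c -> exists h, in_H h /\ (forall z, z <= c -> h z = g z) /\ h s = t.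
Proof.
  intros Hg Hcs Hs1 Hgt Ht1 Hc.
  set (k := glue s (line c (g c) s t) (glue 1 (line s t 1 1) (fun x => x))).
  assert (E1 : line s t 1 1 1 = 1) by (apply line_r; auto).
  assert (E2 : line c (g c) s t s = glue 1 (line s t 1 1) (fun x => x) s).
  { rewrite glue_le by lra. rewrite line_r, line_l; auto. }
  assert (Ec : g c = k c).
  { unfold k; rewrite glue_le by lra. rewrite line_l; auto. }
  exists (glue c g k); split; [|split].
  - apply incbij_in_H.
    + repeat apply incbij_glue; auto using in_H_incbij, incbij_line, incbij_id.
    + intros x Hx. assert (Hx' := Hx). apply not_I01 in Hx'. destruct Hx' as [h|h].
      * rewrite glue_le by lra. apply in_H_off; auto.
      * unfold k. rewrite !glue_gt by lra. auto.
  - intros z Hz; apply glue_le; auto.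
  - rewrite glue_gt by auto. unfold k. rewrite glue_le by lra. apply line_r; auto.
Qed.

(** * Words in two generators *)

(* The letter [(i, true)] stands for the generator [i], and [(i, false)] for its
   inverse.  Words are written in order of application: the head acts first. *)
Definition letter : Type := bool * bool.

Definition Hpair (g : bool -> R -> R) : Prop := forall i, in_H (g i).

Definition act (g : bool -> R -> R) (a : letter) : R -> R :=
  if snd a then g (fst a) else hinv (g (fst a)).

Definition linv (a : letter) : letter := (fst a, negb (snd a)).

Fixpoint run (g : bool -> R -> R) (w : list letter) (x : R) : R :=
  match w with
  | [] => x
  | a :: w' => run g w' (act g a x)
  end.

Definition winv (w : list letter) : list letter := rev (map linv w).

Lemma linvK a : linv (linv a) = a.
Proof. destruct a as [i []]; reflexivity. Qed.

Lemma in_H_act g a : Hpair g -> in_H (act g a).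
Proof. intros H; unfold act; destruct (snd a); auto using in_H_hinv. Qed.

Lemma act_incbij g a : Hpair g -> incbij (act g a).
Proof. intros; apply in_H_incbij, in_H_act; auto. Qed.

Lemma act_linvK g a x : Hpair g -> act g (linv a) (act g a x) = x.
Proof.
  intros H; pose proof (in_H_incbij _ (H (fst a))) as Hi.
  unfold act, linv; destruct a as [i []]; simpl in *; auto using hinvK, Khinv.
Qed.

Lemma act_Klinv g a x : Hpair g -> act g a (act g (linv a) x) = x.
Proof. intros H. rewrite <- (linvK a) at 1. apply act_linvK; auto. Qed.

Lemma in_H_run g w : Hpair g -> in_H (run g w).
Proof.
  intros H; induction w as [|a w IH]; [exact in_H_id|].
  exact (in_H_comp _ _ IH (in_H_act g a H)).
Qed.

Lemma run_incbij g w : Hpair g -> incbij (run g w).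
Proof. intros; apply in_H_incbij, in_H_run; auto. Qed.

Lemma run_app g v w x : run g (v ++ w) x = run g w (run g v x).
Proof. revert x; induction v as [|a v IH]; simpl; auto. Qed.

Lemma winv_cons a w : winv (a :: w) = winv w ++ [linv a].
Proof. reflexivity. Qed.

Lemma winv_snoc w a : winv (w ++ [a]) = linv a :: winv w.
Proof. unfold winv; rewrite map_app, rev_app_distr; reflexivity. Qed.

Lemma run_winvK g w x : Hpair g -> run g (winv w) (run g w x) = x.
Proof.
  intros H; revert x; induction w as [|a w IH]; intros x; auto.
  rewrite winv_cons, run_app; simpl. rewrite IH. apply act_linvK; auto.
Qed.

Lemma run_Kwinv g w x : Hpair g -> run g w (run g (winv w) x) = x.
Proof.
  intros H; apply (incbij_inj (run g (winv w))); [apply run_incbij; auto|].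
  apply run_winvK; auto.
Qed.

(** The argument [a] is the letter preceding [w]; carrying it along makes the condition split over
    concatenations. *)
Fixpoint reduced_from (a : letter) (w : list letter) : Prop :=
  match w with
  | [] => True
  | b :: w' => b <> linv a /\ reduced_from b w'
  end.

(** The empty word is excluded, since it evaluates to the identity for every pair: these are the
    words of the nontrivial elements of the free group. *)
Definition reduced (w : list letter) : Prop :=
  match w with
  | [] => False
  | a :: w' => reduced_from a w'
  end.

Lemma last_cons (a d : letter) w : last (a :: w) d = last w a.
Proof.
  revert a d; induction w as [|c w IH]; intros a d; auto.
  change (last (c :: w) d = last (c :: w) a). rewrite !IH; auto.
Qed.

Lemma last_app_cons (b d : letter) v w : last (v ++ b :: w) d = last w b.
Proof.
  revert d; induction v as [|c v IH]; intros d; [apply last_cons|].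
  rewrite <- app_comm_cons, last_cons; auto.
Qed.

Lemma reduced_from_app a v w :
  reduced_from a (v ++ w) <-> reduced_from a v /\ reduced_from (last v a) w.
Proof.
  revert a; induction v as [|b v IH]; intros a; [simpl; tauto|].
  rewrite last_cons. simpl (reduced_from _ (_ ++ _)). simpl (reduced_from a (_ :: _)).
  rewrite IH. tauto.
Qed.

(** The first letter of the inverse word is exposed because it decides whether cancellation occurs
    where that word is appended to another. *)
Lemma reduced_from_winv a w : reduced_from a w ->
  exists b v, winv w ++ [linv a] = b :: v /\ b = linv (last w a) /\ reduced_from b v.
Proof.
  revert a; induction w as [|c w IH]; intros a H.
  - exists (linv a), []; simpl; auto.
  - destruct H as [Hc H]. destruct (IH c H) as (b & v & E & Eb & Hv).
    exists b, (v ++ [linv a]). rewrite winv_cons, E, last_cons. repeat split; auto.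
    rewrite reduced_from_app; split; auto. simpl; split; auto.
    assert (last v b = linv c) as ->.
    { rewrite <- (last_cons b b), <- E. apply last_last. }
    rewrite linvK. intros h; apply Hc; rewrite <- h; reflexivity.
Qed.

(** * Continuity and meagerness *)

Definition near (l : list R) (eps : R) (g g' : bool -> R -> R) : Prop :=
  forall i a, In a l -> Rabs (g' i a - g i a) < eps.

Lemma near_weaken l l' e e' g g' : incl l l' -> e' <= e ->
  near l' e' g g' -> near l e g g'.
Proof. intros Hl He H i a Ha. specialize (H i a (Hl a Ha)). lra. Qed.

(** By monotonicity, control of the generator at two points around [x], or around the preimage of
    [x] for an inverse letter, gives control at everything between them. *)
Lemma act_continuous g a x eps : Hpair g -> 0 < eps ->
  exists l delta, 0 < delta /\ forall g' x', Hpair g' -> near l delta g g' ->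
    Rabs (x' - x) < delta -> Rabs (act g' a x' - act g a x) < eps.
Proof.
  intros Hg He; destruct a as [i s]; unfold act; simpl.
  pose proof (in_H_incbij _ (Hg i)) as Hi. destruct s.
  - destruct (incbij_continuous (g i) x (eps / 2) Hi) as (e & He' & Hc); [lra|].
    exists [x - e / 2; x + e / 2], (Rmin (e / 2) (eps / 2)).
    split; [apply Rmin_pos; lra|]. intros g' x' Hg' Hn Hx.
    pose proof (in_H_incbij _ (Hg' i)) as Hi'.
    pose proof (Rmin_l (e / 2) (eps / 2)); pose proof (Rmin_r (e / 2) (eps / 2)).
    assert (H1 : Rabs (g i (x - e / 2) - g i x) < eps / 2).
    { apply Hc. replace (x - e / 2 - x) with (- (e / 2)) by ring.
      rewrite Rabs_Ropp, Rabs_right; lra. }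
    assert (H2 : Rabs (g i (x + e / 2) - g i x) < eps / 2).
    { apply Hc. replace (x + e / 2 - x) with (e / 2) by ring. rewrite Rabs_right; lra. }
    assert (K1 := Hn i (x - e / 2)). assert (K2 := Hn i (x + e / 2)). simpl in K1, K2.
    specialize (K1 (or_introl eq_refl)). specialize (K2 (or_intror (or_introl eq_refl))).
    apply Rabs_def2 in H1, H2, K1, K2, Hx.
    assert (g' i (x - e / 2) <= g' i x') by (apply incbij_le; auto; lra).
    assert (g' i x' <= g' i (x + e / 2)) by (apply incbij_le; auto; lra).
    apply Rabs_def1; lra.
  - set (y := hinv (g i) x). assert (Ey : g i y = x) by (apply hinvK; auto).
    assert (g i (y - eps) < g i y) by (apply Hi; lra).
    assert (g i y < g i (y + eps)) by (apply Hi; lra).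
    set (d := Rmin (x - g i (y - eps)) (g i (y + eps) - x)).
    assert (0 < d) by (apply Rmin_pos; lra).
    assert (d <= x - g i (y - eps)) by apply Rmin_l.
    assert (d <= g i (y + eps) - x) by apply Rmin_r.
    exists [y - eps; y + eps], (d / 2). split; [lra|]. intros g' x' Hg' Hn Hx.
    pose proof (in_H_incbij _ (Hg' i)) as Hi'.
    assert (K1 := Hn i (y - eps)). assert (K2 := Hn i (y + eps)). simpl in K1, K2.
    specialize (K1 (or_introl eq_refl)). specialize (K2 (or_intror (or_introl eq_refl))).
    apply Rabs_def2 in K1, K2, Hx.
    assert (Ey' : g' i (hinv (g' i) x') = x') by (apply hinvK; auto).
    set (y' := hinv (g' i) x') in *.
    assert (y - eps < y') by (apply (incbij_lt_inv (g' i)); auto; lra).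
    assert (y' < y + eps) by (apply (incbij_lt_inv (g' i)); auto; lra).
    apply Rabs_def1; lra.
Qed.

Lemma run_continuous_joint g w x eps : Hpair g -> 0 < eps ->
  exists l delta, 0 < delta /\ forall g' x', Hpair g' -> near l delta g g' ->
    Rabs (x' - x) < delta -> Rabs (run g' w x' - run g w x) < eps.
Proof.
  intros Hg; revert x; induction w as [|a w IH]; intros x He; simpl.
  - exists [], eps; auto.
  - destruct (IH (act g a x) He) as (l & d & Hd & H).
    destruct (act_continuous g a x d Hg Hd) as (l' & d' & Hd' & H').
    exists (l ++ l'), (Rmin d d'); split; [apply Rmin_pos; auto|].
    intros g' x' Hg' Hn Hx.
    pose proof (Rmin_l d d'); pose proof (Rmin_r d d').
    apply H; auto; [eapply near_weaken; [|eauto|eauto]; auto using incl_appl, incl_refl|].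
    apply H'; auto; [|lra].
    eapply near_weaken; [|eauto|eauto]; auto using incl_appr, incl_refl.
Qed.

Lemma run_continuous g w pts eps : Hpair g -> 0 < eps ->
  exists l delta, 0 < delta /\ forall g', Hpair g' -> near l delta g g' ->
    forall x, In x pts -> Rabs (run g' w x - run g w x) < eps.
Proof.
  intros Hg He; induction pts as [|x pts IH]; [exists [], 1; split; [lra|simpl; tauto]|].
  destruct IH as (l & d & Hd & H).
  destruct (run_continuous_joint g w x eps Hg He) as (l' & d' & Hd' & H').
  exists (l ++ l'), (Rmin d d'); split; [apply Rmin_pos; auto|].
  intros g' Hg' Hn y [<-|Hy].
  - apply H'; auto; [|rewrite Rminus_diag, Rabs_R0; auto].
    eapply near_weaken; [| |eauto]; [auto using incl_appr, incl_refl|apply Rmin_r].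
  - apply H; auto.
    eapply near_weaken; [| |eauto]; [auto using incl_appl, incl_refl|apply Rmin_l].
Qed.

(** Elements of H agree off [0,1], so constraints there hold automatically. The continuity lemmas
    may produce such points, which [basic_ok] does not allow. *)
Lemma restrict_I01 (l : list R) : exists l', (forall a, In a l' -> I01 a) /\
  forall f g eps, in_H f -> in_H g -> 0 < eps ->
    (forall a, In a l' -> Rabs (g a - f a) < eps) ->
    forall a, In a l -> Rabs (g a - f a) < eps.
Proof.
  induction l as [|x l (l' & Hl' & H)]; [exists []; simpl; tauto|].
  destruct (classic (I01 x)) as [hx|hx].
  - exists (x :: l'); split; [intros a [<-|]; auto|].
    intros f g eps Hf Hg He Hn a [<-|Ha]; [apply Hn; left; auto|].
    apply H; auto. intros b Hb; apply Hn; right; auto.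
  - exists l'; split; auto. intros f g eps Hf Hg He Hn a [<-|Ha]; [|apply H; auto].
    rewrite (in_H_off f), (in_H_off g), Rminus_diag, Rabs_R0; auto.
Qed.

Lemma finite_margin f g l eps : (forall a : R, In a l -> Rabs (g a - f a) < eps) ->
  exists d, 0 < d /\ forall a, In a l -> Rabs (g a - f a) + d <= eps.
Proof.
  induction l as [|x l IH]; intros H; [exists 1; split; [lra|simpl; tauto]|].
  destruct IH as (d & Hd & Hl); [intros; apply H; right; auto|].
  assert (Hx : Rabs (g x - f x) < eps) by (apply H; left; auto).
  exists (Rmin d (eps - Rabs (g x - f x))); split; [apply Rmin_pos; lra|].
  pose proof (Rmin_l d (eps - Rabs (g x - f x))).
  pose proof (Rmin_r d (eps - Rabs (g x - f x))).
  intros a [<-|Ha]; [lra|specialize (Hl a Ha); lra].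
Qed.

Lemma basic_open f l eps : (forall a, In a l -> I01 a) -> H_open (basic f l eps).
Proof.
  intros Hl; split; [intros g [Hg _]; auto|]. intros g [Hg Hn].
  destruct (finite_margin f g l eps Hn) as (d & Hd & Hm).
  exists l, d; split; [split; auto|]. intros h [Hh Hn']; split; auto.
  intros a Ha. specialize (Hm a Ha); specialize (Hn' a Ha).
  replace (h a - f a) with ((h a - g a) + (g a - f a)) by ring.
  pose proof (Rabs_triang (h a - g a) (g a - f a)); lra.
Qed.

Definition pair_of (a b : R -> R) (i : bool) : R -> R := if i then a else b.

(** Arbitrarily close to any pair there is one with a whole neighbourhood missing [A], so no
    nonempty open set lies in the closure of [A]. *)
Lemma nowhere_dense_intro (A : H2Set) :
  (forall g l eps, Hpair g -> 0 < eps -> exists g', Hpair g' /\ near l eps g g' /\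
    exists l' d, 0 < d /\ forall h, Hpair h -> near l' d g' h -> ~ A (h true) (h false)) ->
  H2_nowhere_dense A.
Proof.
  intros H (O & [HO1 HO2] & (a & b & Oab) & Hcl).
  destruct (HO1 a b Oab) as [Ha Hb].
  destruct (HO2 a b Oab) as (l1 & e1 & l2 & e2 & [Hl1 He1] & [Hl2 He2] & HO).
  destruct (H (pair_of a b) (l1 ++ l2) (Rmin e1 e2)) as (g & Hg & Hn & l & d & Hd & HA);
    [intros []; auto|apply Rmin_pos; auto|].
  assert (Og : O (g true) (g false)).
  { pose proof (Rmin_l e1 e2); pose proof (Rmin_r e1 e2).
    apply HO; (split; [apply Hg|]); intros x Hx.
    - assert (h := Hn true x (in_or_app _ _ _ (or_introl Hx))). simpl in h; lra.
    - assert (h := Hn false x (in_or_app _ _ _ (or_intror Hx))). simpl in h; lra. }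
  destruct (restrict_I01 l) as (l' & Hl' & Hr).
  destruct (Hcl _ _ Og) as (_ & _ & Hc).
  destruct (Hc (fun c e => basic (g true) l' d c /\ basic (g false) l' d e))
    as (c & e & [[Hc1 Hc2] [He1' He2']] & HAce).
  - split; [intros c e [[? _] [? _]]; auto|].
    intros c e [Bc Be].
    destruct (proj2 (basic_open (g true) l' d Hl') c Bc) as (m1 & k1 & ok1 & H1).
    destruct (proj2 (basic_open (g false) l' d Hl') e Be) as (m2 & k2 & ok2 & H2).
    exists m1, k1, m2, k2; auto.
  - split; (split; [apply Hg|]); intros; rewrite Rminus_diag, Rabs_R0; auto.
  - apply (HA (pair_of c e)); auto; [intros []; auto|].
    intros [] x; simpl; apply Hr; auto.
Qed.

(** * Ascending runs *)

Fixpoint ascending (g : bool -> R -> R) (w : list letter) (x : R) : Prop :=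
  match w with
  | [] => True
  | a :: w' => x < act g a x /\ ascending g w' (act g a x)
  end.

Lemma ascending_app g v w x :
  ascending g (v ++ w) x <-> ascending g v x /\ ascending g w (run g v x).
Proof. revert x; induction v as [|a v IH]; intros; simpl; [|rewrite IH]; tauto. Qed.

Lemma ascending_le g w x : ascending g w x -> x <= run g w x.
Proof.
  revert x; induction w as [|a w IH]; simpl; intros x; [lra|].
  intros [h H]; apply IH in H; lra.
Qed.

(** A letter followed by its inverse would bring the point back down. *)
Lemma ascending_reduced_from g a w x : Hpair g ->
  ascending g (a :: w) x -> reduced_from a w.
Proof.
  intros Hg; revert a x; induction w as [|b w IH]; simpl; auto.
  intros a x (Ha & Hb & H); split; [|apply (IH b (act g a x)); split; auto].
  intros ->. rewrite act_linvK in Hb; auto; lra.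
Qed.

Lemma in_H_interior f x : in_H f -> 0 < x < 1 -> 0 < f x < 1.
Proof.
  intros Hf Hx; pose proof (in_H_incbij f Hf) as Hi.
  pose proof (in_H_0 f Hf); pose proof (in_H_1 f Hf).
  assert (f 0 < f x) by (apply Hi; lra). assert (f x < f 1) by (apply Hi; lra). lra.
Qed.

Definition no_common_fixpoint (g : bool -> R -> R) : Prop :=
  forall z, 0 < z < 1 -> exists i, g i z <> z.

Lemma ascending_letter g z : Hpair g -> no_common_fixpoint g -> 0 < z < 1 ->
  exists a, z < act g a z.
Proof.
  intros Hg Hf Hz. destruct (Hf z Hz) as [i Hi].
  destruct (Rtotal_order z (g i z)) as [h|[h|h]]; [exists (i, true); auto|lra|].
  exists (i, false). unfold act; simpl.
  apply (incbij_lt_inv (g i)); [apply in_H_incbij; auto|].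
  rewrite hinvK; auto using in_H_incbij.
Qed.

(* Otherwise the supremum of the points reached would be a common fixed point. *)
Lemma ascending_reach g x y : Hpair g -> no_common_fixpoint g -> 0 < x < 1 -> y < 1 ->
  exists u, ascending g u x /\ y < run g u x.
Proof.
  intros Hg Hf Hx Hy. apply NNPP; intros Hno.
  assert (Hle : forall u, ascending g u x -> run g u x <= y).
  { intros u Hu. apply Rnot_lt_le; intros h; apply Hno; eauto. }
  destruct (completeness (fun z => exists u, ascending g u x /\ z = run g u x))
    as [s [Hs1 Hs2]].
  - exists y. intros z (u & Hu & ->); auto.
  - exists x, []; simpl; auto.
  - assert (s <= y) by (apply Hs2; intros z (u & Hu & ->); auto).
    assert (x <= s) by (apply Hs1; exists []; simpl; auto).
    destruct (ascending_letter g s) as [a Ha]; auto; [lra|].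
    (* Some point reached lies above the preimage of [s] under [a]; one more application of [a]
       carries it beyond the supremum [s]. *)
    assert (Hlt : act g (linv a) s < s).
    { apply (incbij_lt_inv (act g a)); [apply act_incbij; auto|].
      rewrite act_Klinv; auto. }
    assert (exists u, ascending g u x /\ act g (linv a) s < run g u x) as (u & Hu & Hr).
    { apply NNPP; intros Hn. assert (s <= act g (linv a) s); [|lra].
      apply Hs2. intros z (u & Hu & ->). apply Rnot_lt_le; intros h; apply Hn; eauto. }
    apply (act_incbij g a Hg) in Hr. rewrite act_Klinv in Hr by auto.
    assert (run g u x <= s) by (apply Hs1; eauto).
    assert (act g a (run g u x) <= s); [|lra].
    apply Hs1; exists (u ++ [a]); split; [|rewrite run_app; auto].
    apply ascending_app; split; auto. simpl; split; auto; lra.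
Qed.

(** An ascending run ending at or below [y] stays below [y], so it only sees the part of the graphs
    where argument and value are both at most [y]. *)
Lemma ascending_agree g g' u x y : Hpair g -> Hpair g' ->
  (forall i z, z <= y -> g i z <= y -> g' i z = g i z) ->
  ascending g u x -> run g u x <= y -> run g' u x = run g u x.
Proof.
  intros Hg Hg' Ha; revert x; induction u as [|[i s] u IH]; intros x; auto.
  intros [H1 H2] H3. pose proof (ascending_le _ _ _ H2) as H4. simpl in H3.
  assert (E : act g' (i, s) x = act g (i, s) x); [|simpl; rewrite E; auto].
  unfold act in *; destruct s; simpl in *.
  - apply Ha; lra.
  - apply (incbij_inj (g' i)); [apply in_H_incbij; auto|].
    assert (E : g i (hinv (g i) x) = x) by auto using hinvK, in_H_incbij.
    rewrite hinvK by auto using in_H_incbij. rewrite Ha; lra.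
Qed.

(* The generators may still be redefined above [c i]; this is the state reached
   after an ascending step to [x] by the letter [l]. *)
Definition frontier (g : bool -> R -> R) (l : letter) (x : R) (c : bool -> R) : Prop :=
  forall i, 0 <= c i /\ c i <= x /\ g i (c i) <= x /\
    (c i = x -> l = (i, false)) /\ (g i (c i) = x -> l = (i, true)).

Definition update {T} (i : bool) (t : T) (g : bool -> T) (j : bool) : T :=
  if Bool.eqb j i then t else g j.

Lemma update_eq {T} i (t : T) g : update i t g i = t.
Proof. unfold update; rewrite Bool.eqb_reflx; auto. Qed.

Lemma update_neq {T} i j (t : T) g : j <> i -> update i t g j = g j.
Proof. intros h; unfold update; apply Bool.eqb_false_iff in h; rewrite h; auto. Qed.

(** Each letter of [w] is made ascending by adding one point to the graph of its generator, above
    the part already frozen. The new point becomes the frontier of that generator, and the other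
    generator lies strictly below the new position. *)
Lemma ascending_extension w : forall g l x c, Hpair g -> 0 < x < 1 ->
  frontier g l x c -> reduced_from l w ->
  exists g', Hpair g' /\ (forall i z, z <= c i -> g' i z = g i z) /\ ascending g' w x.
Proof.
  induction w as [|[i s] w IH]; intros g l x c Hg Hx Hfr; simpl.
  { intros _; exists g; auto. }
  intros [Hl Hw]. destruct (Hfr i) as (Hc0 & Hc1 & Hc2 & Hc3 & Hc4).
  set (x' := (x + 1) / 2). assert (Hx' : x < x' < 1) by (unfold x'; lra).
  (* The letter sends [x] to [x'] exactly when (p, q) is on the graph of generator [i]; [x'] could
     be any point strictly between [x] and 1. *)
  set (p := if s then x else x'). set (q := if s then x' else x).
  assert (Hpq : c i < p /\ p < 1 /\ g i (c i) < q /\ q < 1 /\ p <= x' /\ q <= x').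
  (* A frozen point level with [x] would make the previous letter the inverse of the present one,
     contrary to reducedness. *)
  { unfold p, q; destruct s; repeat split; try lra.
    - destruct (Rle_lt_or_eq_dec _ _ Hc1) as [|e]; auto.
      exfalso; apply Hl; rewrite (Hc3 e); auto.
    - destruct (Rle_lt_or_eq_dec _ _ Hc2) as [|e]; auto.
      exfalso; apply Hl; rewrite (Hc4 e); auto. }
  destruct Hpq as (Hp & Hp1 & Hq & Hq1 & Hpx & Hqx).
  destruct (extend_above (g i) (c i) p q) as (h & Hh & Hhc & Hhp); auto.
  set (g1 := update i h g). set (c1 := update i p c).
  assert (Hg1 : Hpair g1).
  { intros j; unfold g1. destruct (Bool.bool_dec j i) as [->|n];
      [rewrite update_eq|rewrite update_neq]; auto. }
  destruct (IH g1 (i, s) x' c1) as (g' & Hg' & Hag & Has); auto; [lra| |].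
  { intros j; unfold g1, c1. destruct (Bool.bool_dec j i) as [->|n].
    - rewrite !update_eq, Hhp. repeat split; try lra; unfold p, q; destruct s; auto; lra.
    - rewrite !update_neq by auto. destruct (Hfr j) as (? & ? & ? & _ & _).
      repeat split; lra. }
  exists g'; split; [auto|split].
  - intros j z Hz. destruct (Bool.bool_dec j i) as [->|n].
    + rewrite Hag; unfold g1, c1; rewrite update_eq; [auto|lra].
    + rewrite Hag; unfold g1, c1; rewrite update_neq; auto.
  - assert (E : act g' (i, s) x = x'); [|rewrite E; split; auto; lra].
    assert (Ep : g' i p = q).
    { rewrite Hag; unfold g1, c1; rewrite update_eq; auto; lra. }
    unfold act, p, q in *; destruct s; simpl; auto.
    rewrite <- Ep. apply Khinv, in_H_incbij; auto.
Qed.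

(** Below 1, the constrained points and their images stay under [y], so generators changed only
    above that height keep the values at [l]. The bound 3/4 is the height that the escaping point
    must exceed. *)
Lemma threshold (g : bool -> R -> R) (l : list R) : Hpair g ->
  exists y, 3 / 4 <= y < 1 /\ forall a, In a l -> 1 <= a \/ a <= y /\ forall i, g i a <= y.
Proof.
  intros Hg; induction l as [|a l (y & Hy & H)].
  { exists (3 / 4); split; [lra|simpl; tauto]. }
  destruct (Rle_or_lt 1 a) as [h|h].
  { exists y; split; auto. intros b [<-|Hb]; auto. }
  assert (Hi : forall i, g i a < 1).
  { intros i. rewrite <- (in_H_1 (g i)) by auto. apply in_H_incbij; auto. }
  set (m := Rmax a (Rmax (g true a) (g false a))).
  exists (Rmax y m). pose proof (Rmax_l y m); pose proof (Rmax_r y m).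
  assert (a <= m) by apply Rmax_l.
  assert (Hm : forall i, g i a <= m).
  { intros []; eapply Rle_trans; [|apply Rmax_r| |apply Rmax_r]; [apply Rmax_l|apply Rmax_r]. }
  split.
  - split; [lra|]. unfold m. repeat apply Rmax_lub_lt; auto; lra.
  - intros b [<-|Hb].
    + right; split; [lra|]. intros i; specialize (Hm i); lra.
    + destruct (H b Hb) as [|[h1 h2]]; auto. right; split; [lra|].
      intros i; specialize (h2 i); lra.
Qed.

(** Ascend from 1/2 past the threshold by [u], then once more by [a]. Beyond this point the
    generators are free, and any continuation without cancellation after [a] can be made
    ascending. *)
Lemma escape g l : Hpair g -> no_common_fixpoint g ->
  exists u a, reduced (u ++ [a]) /\ forall w, reduced_from a w ->
    exists g', Hpair g' /\ (forall i z, In z l -> g' i z = g i z) /\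
      3 / 4 < run g' (u ++ a :: w) (1 / 2).
Proof.
  intros Hg Hf. destruct (threshold g l Hg) as (y0 & Hy0 & Hl).
  destruct (ascending_reach g (1 / 2) y0) as (u & Hu & Hur); auto; try lra.
  set (y := run g u (1 / 2)) in *.
  assert (Hy : 0 < y < 1) by (apply in_H_interior; [apply in_H_run; auto|lra]).
  destruct (ascending_letter g y) as [a Ha]; auto.
  set (x := act g a y) in *.
  assert (Hx : 0 < x < 1) by (apply in_H_interior; [apply in_H_act; auto|lra]).
  exists u, a; split.
  { assert (Hua : ascending g (u ++ [a]) (1 / 2)).
    { apply ascending_app; split; auto. simpl; auto. }
    destruct (u ++ [a]) as [|b v] eqn:E; [destruct u; discriminate|].
    eapply ascending_reduced_from; eauto. }
  intros w Hw. destruct a as [i s].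
  (* The generator of [a] is frozen up to the graph point that makes [a] send [y] to [x]; the other
     one up to the largest point whose argument and value are both at most [y]. *)
  set (c := update i (if s then y else x) (fun j => Rmin y (hinv (g j) y))).
  assert (Hgi : if s then g i y = x else g i x = y).
  { destruct s; auto. unfold x, act; simpl. apply hinvK, in_H_incbij; auto. }
  destruct (ascending_extension w g (i, s) x c) as (g' & Hg' & Hag & Has); auto.
  { intros j; unfold c. destruct (Bool.bool_dec j i) as [->|n].
    - rewrite update_eq. destruct s; rewrite Hgi; repeat split; auto; lra.
    - rewrite update_neq by auto.
      assert (Hj : incbij (g j)) by (apply in_H_incbij; auto).
      assert (0 < hinv (g j) y < 1) by (apply in_H_interior; [apply in_H_hinv|]; auto).
      pose proof (Rmin_l y (hinv (g j) y)).
      assert (g j (Rmin y (hinv (g j) y)) <= g j (hinv (g j) y))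
        by (apply incbij_le, Rmin_r; auto).
      rewrite hinvK in * by auto.
      assert (0 < Rmin y (hinv (g j) y)) by (apply Rmin_pos; lra).
      repeat split; lra. }
  assert (Hlow : forall j z, z <= y -> g j z <= y -> g' j z = g j z).
  { intros j z Hz Hgz. apply Hag. unfold c. destruct (Bool.bool_dec j i) as [->|n].
    - rewrite update_eq; destruct s; lra.
    - rewrite update_neq by auto. apply Rmin_glb; auto.
      apply (incbij_le_inv (g j)); [apply in_H_incbij; auto|].
      rewrite hinvK; auto using in_H_incbij. }
  exists g'; split; [auto|split].
  - intros j z Hz. destruct (Hl z Hz) as [h|[h1 h2]].
    + destruct h as [h|<-]; [|rewrite !in_H_1; auto].
      rewrite !in_H_off; auto; apply not_I01; lra.
    + specialize (h2 j). apply Hlow; lra.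
  - rewrite run_app; simpl.
    rewrite (ascending_agree g g' u (1 / 2) y) by (auto; unfold y; lra). fold y.
    assert (act g' (i, s) y = x) as ->.
    { unfold act; destruct s; simpl.
      - rewrite Hag; auto. unfold c; rewrite update_eq; lra.
      - rewrite <- Hgi, <- (Hag i x); [apply Khinv, in_H_incbij; auto|].
        unfold c; rewrite update_eq; lra. }
    apply ascending_le in Has. lra.
Qed.

(** * Pairs without common fixed points are dense *)

Lemma incbij_affine m b : 0 < m -> incbij (fun x => m * x + b).
Proof.
  intros Hm; split.
  - intros x y h. apply (Rmult_lt_compat_l m) in h; lra.
  - intros y; exists ((y - b) / m); field; lra.
Qed.

(** Common germs at 0 and 1: the first moves points of (0,1) down, the second moves them up. The
    [+ 0] matches the shape in [incbij_affine]. *)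
Definition lower_end (x : R) : R := / 2 * x + 0.
Definition upper_end (x : R) : R := / 2 * x + / 2.

(** Keep [f] on [p, 1 - p], use the two germs within [e] of the endpoints, and join by segments; the
    last two hypotheses make these segments increasing. *)
Lemma normalize_ends f e p : in_H f -> 0 < e < p -> p < / 2 -> e / 2 < f p ->
  e / 2 < 1 - f (1 - p) ->
  exists f', in_H f' /\ (forall z, z <= 0 \/ 1 <= z \/ p <= z <= 1 - p -> f' z = f z) /\
    (forall z, 0 <= z <= e -> f' z = lower_end z) /\
    (forall z, 1 - e <= z <= 1 -> f' z = upper_end z).
Proof.
  intros Hf He Hp He1 He2. pose proof (in_H_incbij f Hf) as Hi.
  set (k5 := glue 1 upper_end (fun x => x)).
  set (k4 := glue (1 - e) (line (1 - p) (f (1 - p)) (1 - e) (upper_end (1 - e))) k5).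
  set (k3 := glue (1 - p) f k4).
  set (k2 := glue p (line e (lower_end e) p (f p)) k3).
  set (k1 := glue e lower_end k2).
  set (k0 := glue 0 (fun x => x) k1).
  assert (E5 : upper_end 1 = 1) by (unfold upper_end; lra).
  assert (E4 : line (1 - p) (f (1 - p)) (1 - e) (upper_end (1 - e)) (1 - e) = k5 (1 - e)).
  { rewrite line_r by lra. unfold k5; rewrite glue_le by lra; auto. }
  assert (E3 : f (1 - p) = k4 (1 - p)).
  { unfold k4; rewrite glue_le, line_l by lra; auto. }
  assert (E2 : line e (lower_end e) p (f p) p = k3 p).
  { rewrite line_r by lra. unfold k3; rewrite glue_le by lra; auto. }
  assert (E1 : lower_end e = k2 e).
  { unfold k2; rewrite glue_le, line_l by lra; auto. }
  assert (E0 : 0 = k1 0).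
  { unfold k1; rewrite glue_le by lra; unfold lower_end; lra. }
  assert (U : incbij upper_end) by (apply incbij_affine; lra).
  assert (L : incbij lower_end) by (apply incbij_affine; lra).
  assert (f (1 - p) < upper_end (1 - e)) by (unfold upper_end; lra).
  assert (lower_end e < f p) by (unfold lower_end; lra).
  assert (I5 : incbij k5) by (apply incbij_glue; auto using incbij_id).
  assert (I4 : incbij k4) by (apply incbij_glue; auto; apply incbij_line; lra).
  assert (I3 : incbij k3) by (apply incbij_glue; auto).
  assert (I2 : incbij k2) by (apply incbij_glue; auto; apply incbij_line; lra).
  assert (I1 : incbij k1) by (apply incbij_glue; auto).
  assert (Hoff : forall z, z <= 0 \/ 1 <= z -> k0 z = z).
  { intros z [h|h]; unfold k0; [rewrite glue_le; auto|].
    rewrite glue_gt by lra. unfold k1, k2, k3, k4. rewrite !glue_gt by lra.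
    unfold k5; rewrite glue_ge; auto. }
  assert (Hoff' : forall z, z <= 0 \/ 1 <= z -> f z = z).
  { intros z [[h|h]|[h|h]].
    - apply in_H_off, not_I01; auto.
    - subst z; apply in_H_0; auto.
    - apply in_H_off, not_I01; auto.
    - subst z; apply in_H_1; auto. }
  exists k0; split; [|split; [|split]].
  - apply incbij_in_H; [apply incbij_glue; auto using incbij_id|].
    intros x Hx; apply Hoff; apply not_I01 in Hx; lra.
  - intros z [h|[h|h]]; [rewrite Hoff, Hoff'; auto|rewrite Hoff, Hoff'; auto|].
    unfold k0, k1. rewrite !glue_gt by lra. unfold k2. rewrite glue_ge by (auto; lra).
    unfold k3; rewrite glue_le; lra.
  - intros z h; unfold k0. rewrite glue_ge by (auto; lra). unfold k1; rewrite glue_le; lra.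
  - intros z h; unfold k0, k1, k2, k3. rewrite !glue_gt by lra.
    unfold k4. rewrite glue_ge by (auto; lra). unfold k5. rewrite glue_le; lra.
Qed.

Lemma finite_gap (l : list R) : exists p, 0 < p < / 2 /\
  forall a, In a l -> a <= 0 \/ 1 <= a \/ p <= a <= 1 - p.
Proof.
  induction l as [|a l (p & Hp & H)]; [exists (/ 4); split; [lra|simpl; tauto]|].
  destruct (Rle_or_lt a 0) as [h0|h0].
  { exists p; split; auto. intros b [<-|Hb]; auto. }
  destruct (Rle_or_lt 1 a) as [h1|h1].
  { exists p; split; auto. intros b [<-|Hb]; auto. }
  set (m := Rmin a (1 - a)). assert (0 < m) by (apply Rmin_pos; lra).
  assert (m <= a) by apply Rmin_l. assert (m <= 1 - a) by apply Rmin_r.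
  exists (Rmin p m). assert (0 < Rmin p m) by (apply Rmin_pos; lra).
  pose proof (Rmin_l p m); pose proof (Rmin_r p m). split; [lra|].
  intros b [<-|Hb]; [right; right; lra|]. specialize (H b Hb); lra.
Qed.

Lemma normalize_ends_pair g l : Hpair g -> exists g' e, Hpair g' /\ 0 < e < / 2 /\
  (forall i a, In a l -> g' i a = g i a) /\
  (forall i z, 0 <= z <= e -> g' i z = lower_end z) /\
  (forall i z, 1 - e <= z <= 1 -> g' i z = upper_end z).
Proof.
  intros Hg. destruct (finite_gap l) as (p & Hp & Hl).
  assert (Hb : forall i, exists e, 0 < e <= p /\ e <= g i p /\ e <= 1 - g i (1 - p)).
  { intros i.
    assert (0 < g i p < 1) by (apply in_H_interior; auto; lra).
    assert (0 < g i (1 - p) < 1) by (apply in_H_interior; auto; lra).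
    set (m := Rmin (g i p) (1 - g i (1 - p))).
    exists (Rmin p m).
    assert (0 < m) by (apply Rmin_pos; lra). assert (0 < Rmin p m) by (apply Rmin_pos; lra).
    pose proof (Rmin_l p m); pose proof (Rmin_r p m).
    assert (m <= g i p) by apply Rmin_l. assert (m <= 1 - g i (1 - p)) by apply Rmin_r.
    lra. }
  destruct (Hb true) as (e1 & H1). destruct (Hb false) as (e2 & H2).
  (* One [e] serves both generators; halving makes it strictly less than [p]. *)
  set (e := Rmin e1 e2 / 2). assert (0 < Rmin e1 e2) by (apply Rmin_pos; lra).
  pose proof (Rmin_l e1 e2); pose proof (Rmin_r e1 e2).
  destruct (normalize_ends (g true) e p) as (f1 & F1 & A1 & L1 & U1);
    try (unfold e; lra); auto.
  destruct (normalize_ends (g false) e p) as (f2 & F2 & A2 & L2 & U2);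
    try (unfold e; lra); auto.
  exists (pair_of f1 f2), e.
  split; [intros []; auto|]. split; [unfold e; lra|].
  split; [|split]; intros [] z Hz; simpl; auto.
Qed.

(** On (p, q) this adds [s] times the distance to the nearer endpoint. The dependence on [s] is
    affine, which [perturb] exploits. *)
Definition tent (p q s : R) : R -> R :=
  glue p (fun x => x)
    (glue ((p + q) / 2) (fun x => (1 + s) * x + - s * p)
      (glue q (fun x => (1 - s) * x + s * q) (fun x => x))).

Lemma incbij_tent p q s : p < q -> 0 < s < 1 -> incbij (tent p q s).
Proof.
  intros Hpq Hs; unfold tent. repeat apply incbij_glue; try apply incbij_id;
    try (apply incbij_affine; lra); repeat rewrite glue_le by lra; lra.
Qed.

Lemma tent_off p q s z : p < q -> z <= p \/ q <= z -> tent p q s z = z.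
Proof.
  intros Hpq [h|h]; unfold tent; [rewrite glue_le; lra|].
  rewrite !glue_gt by lra. apply glue_ge; lra.
Qed.

Lemma tent_on p q z : p < z < q ->
  exists t, 0 < t <= q - p /\ forall s, tent p q s z = z + s * t.
Proof.
  intros Hz. destruct (Rle_or_lt z ((p + q) / 2)) as [h|h];
    [exists (z - p)|exists (q - z)]; (split; [lra|]); intros s; unfold tent.
  - rewrite glue_gt, glue_le by lra; ring.
  - rewrite !glue_gt, glue_le by lra; ring.
Qed.

Lemma avoid_finite (B : list R) e : 0 < e -> exists s, 0 < s < e /\ ~ In s B.
Proof.
  intros He.
  assert (H : exists d, 0 < d <= e /\ forall b, In b B -> 0 < b < d -> False).
  { induction B as [|b B (d & Hd & H)]; [exists e; simpl; split; [lra|tauto]|].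
    destruct (Rle_or_lt b 0) as [h|h].
    - exists d; split; auto. intros c [<-|Hc] h'; [lra|eauto].
    - pose proof (Rmin_l d b); pose proof (Rmin_r d b).
      assert (0 < Rmin d b) by (apply Rmin_pos; lra).
      exists (Rmin d b); split; [lra|]. intros c [<-|Hc] h'; [lra|].
      apply (H c Hc); lra. }
  destruct H as (d & Hd & H). exists (d / 2); split; [lra|].
  intros h; apply (H _ h); lra.
Qed.

(** Follow [f] by a tent of parameter [s]. At each point of [F] inside (p, q) the new value is
    strictly increasing in [s], so only one [s] can fix that point; a small [s] avoiding finitely
    many values works. *)
Lemma perturb f p q (F : list R) eps : in_H f -> 0 <= p -> p < q -> q <= 1 -> 0 < eps ->
  exists f', in_H f' /\ (forall z, ~ p < z < q -> f' z = f z) /\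
    (forall z, Rabs (f' z - f z) < eps) /\ (forall z, In z F -> p < z < q -> f' z <> z).
Proof.
  intros Hf Hp Hpq Hq He. pose proof (in_H_incbij f Hf) as Hi.
  assert (Hfpq : f p < f q) by (apply Hi; auto).
  assert (Hon : forall z, p < z < q -> f p < f z < f q) by (split; apply Hi; lra).
  assert (Hoff : forall s z, ~ p < z < q -> tent (f p) (f q) s (f z) = f z).
  { intros s z Hz; apply tent_off; auto.
    destruct (Rle_or_lt z p); [left|right]; apply incbij_le; auto; lra. }
  assert (HB : exists B, forall s, ~ In s B ->
    forall z, In z F -> p < z < q -> tent (f p) (f q) s (f z) <> z).
  { clear He. induction F as [|z F (B & HB)]; [exists []; simpl; tauto|].
    destruct (classic (p < z < q)) as [h|h].
    - destruct (tent_on (f p) (f q) (f z) (Hon z h)) as (t & Ht & E).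
      exists ((z - f z) / t :: B). intros s Hs y [<-|Hy] h'.
      + rewrite E. intros e; apply Hs; left. replace (z - f z) with (s * t) by lra. field; lra.
      + apply HB; auto. intros h2; apply Hs; right; auto.
    - exists B. intros s Hs y [<-|Hy] h'; [tauto|]. apply HB; auto. }
  destruct HB as (B & HB).
  set (D := f q - f p) in *. assert (HD : 0 < D) by (unfold D; lra).
  assert (HeD : 0 < eps / D) by (apply Rdiv_lt_0_compat; lra).
  destruct (avoid_finite B (Rmin 1 (eps / D))) as (s & Hs & HsB); [apply Rmin_pos; lra|].
  pose proof (Rmin_l 1 (eps / D)); pose proof (Rmin_r 1 (eps / D)).
  exists (fun x => tent (f p) (f q) s (f x)). split; [|split; [|split]]; auto.
  - apply incbij_in_H; [apply incbij_comp; auto; apply incbij_tent; auto; lra|].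
    intros x Hx. rewrite Hoff by (apply not_I01 in Hx; lra). apply in_H_off; auto.
  - intros z. destruct (classic (p < z < q)) as [h|h].
    + destruct (tent_on (f p) (f q) (f z) (Hon z h)) as (t & Ht & E). rewrite E.
      replace (f z + s * t - f z) with (s * t) by ring.
      assert (0 < s * t) by (apply Rmult_lt_0_compat; lra).
      rewrite Rabs_right by lra.
      apply Rle_lt_trans with (s * D); [apply Rmult_le_compat_l; unfold D; lra|].
      apply Rlt_le_trans with (eps / D * D).
      * apply Rmult_lt_compat_r; lra.
      * right; field; lra.
    + rewrite Hoff, Rminus_diag, Rabs_R0; auto.
Qed.

(** Interpolate linearly between the points of [l]. A segment with at least one nonfixed end has at
    most one fixed point, so finitely many remain. *)
Lemma linearize l : forall p q f, incbij f -> p < q -> f p <> p \/ f q <> q ->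
  (forall a, In a l -> p < a < q -> f a <> a) ->
  exists g F, incbij g /\ (forall z, ~ p < z < q -> g z = f z) /\
    (forall a, In a l -> g a = f a) /\ (forall z, p < z < q -> g z = z -> In z F).
Proof.
  induction l as [|a l IH]; intros p q f Hf Hpq Hends Hl.
  - assert (Hfpq : f p < f q) by (apply Hf; auto).
    set (L := line p (f p) q (f q)).
    assert (EL : L q = f q) by (apply line_r; auto).
    assert (E1 : L p = f p) by apply line_l.
    assert (E2 : f p = glue q L f p) by (rewrite glue_le by lra; auto).
    set (g := glue p f (glue q L f)).
    assert (Hon : forall z, p < z < q -> g z = L z).
    { intros z Hz; unfold g. rewrite glue_gt, glue_le by lra; auto. }
    assert (HF : exists F, forall z, p < z < q -> L z = z -> In z F).
    { destruct (classic (exists z, p < z < q /\ L z = z)) as [(z0 & Hz0 & E)|Hn].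
      - exists [z0]. intros z Hz Ez; left. apply NNPP; intros hne.
        (* Two fixed points force slope 1, so the segment lies on the diagonal and both ends are
           fixed. *)
        unfold L, line in E, Ez. set (m := (f q - f p) / (q - p)) in *.
        assert (Hm : (z - z0) * (m - 1) = 0) by lra.
        apply Rmult_integral in Hm. destruct Hm as [Hm|Hm]; [lra|].
        assert (m = 1) as Hm1 by lra. rewrite Hm1 in *.
        assert (f q - f p = q - p).
        { replace (f q - f p) with (m * (q - p)) by (unfold m; field; lra). rewrite Hm1; ring. }
        lra.
      - exists []. intros z Hz Ez. apply Hn; eauto. }
    destruct HF as (F & HF). exists g, F. split; [|split; [|split]].
    + repeat apply incbij_glue; auto. apply incbij_line; auto.
    + intros z Hz. destruct (Rle_or_lt z p); unfold g; [apply glue_le; auto|].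
      rewrite glue_gt by auto. apply glue_ge; auto; lra.
    + simpl; tauto.
    + intros z Hz. rewrite Hon; auto.
  - assert (Hl' : forall b, In b l -> p < b < q -> f b <> b) by (intros; apply Hl; [right|]; auto).
    destruct (classic (p < a < q)) as [ha|ha].
    + assert (Hfa : f a <> a) by (apply Hl; [left|]; auto).
      (* The nonfixed point [a] supplies the endpoint hypothesis for both halves. *)
      destruct (IH p a f) as (g1 & F1 & I1 & O1 & A1 & X1); auto; try tauto; try lra.
      { intros b Hb hb; apply Hl'; auto; lra. }
      assert (E1 : g1 a = f a) by (apply O1; lra).
      destruct (IH a q g1) as (g2 & F2 & I2 & O2 & A2 & X2); auto; try lra.
      { intros b Hb hb. rewrite A1; auto. apply Hl'; auto; lra. }
      assert (E2 : g2 a = f a) by (rewrite O2; auto; lra).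
      exists g2, (F1 ++ F2). split; [|split; [|split]]; auto.
      * intros z Hz. rewrite O2, O1; auto; lra.
      * intros b [<-|Hb]; auto. rewrite A2; auto.
      * intros z Hz Ez. apply in_or_app.
        destruct (Rtotal_order z a) as [h|[h|h]].
        -- left; apply X1; [lra|]. rewrite <- O2; auto; lra.
        -- subst z; congruence.
        -- right; apply X2; auto; lra.
    + destruct (IH p q f) as (g & F & I & O & A & X); auto.
      exists g, F; split; [|split; [|split]]; auto. intros b [<-|Hb]; auto.
Qed.

(** After normalizing the ends, move the first generator off fixed points in [l] and linearize it,
    which leaves finitely many fixed points in (e, 1 - e). Then perturb the second generator so that
    it fixes none of them. Near the ends both germs move every interior point. *)
Lemma good_pair_dense g l eps : Hpair g -> 0 < eps -> exists g' e, Hpair g' /\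
  near l eps g g' /\ no_common_fixpoint g' /\ 0 < e < / 2 /\
  (forall i z, 0 <= z <= e -> g' i z = lower_end z) /\
  (forall i z, 1 - e <= z <= 1 -> g' i z = upper_end z).
Proof.
  intros Hg He. destruct (normalize_ends_pair g l Hg) as (k & e & Hk & He2 & Hkl & HL & HU).
  destruct (perturb (k true) e (1 - e) l eps) as (f1 & F1 & O1 & N1 & X1); auto; try lra.
  assert (Ee : f1 e = e / 2).
  { rewrite O1, HL by lra. unfold lower_end; lra. }
  destruct (linearize l e (1 - e) f1) as (h1 & F & I1 & O1' & A1 & Fx1);
    auto using in_H_incbij; try lra.
  destruct (perturb (k false) e (1 - e) F eps) as (h2 & F2 & O2 & N2 & X2); auto; try lra.
  assert (EL : forall i z, 0 <= z <= e -> pair_of h1 h2 i z = lower_end z).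
  { intros [] z Hz; simpl; [rewrite O1', O1|rewrite O2]; try lra; auto. }
  assert (EU : forall i z, 1 - e <= z <= 1 -> pair_of h1 h2 i z = upper_end z).
  { intros [] z Hz; simpl; [rewrite O1', O1|rewrite O2]; try lra; auto. }
  exists (pair_of h1 h2), e. split; [|split; [|split; [|split]]]; auto.
  - intros []; simpl; auto. apply incbij_in_H; auto.
    intros x Hx; assert (Hx' := Hx); apply not_I01 in Hx'.
    rewrite O1' by lra. apply in_H_off; auto.
  - intros [] a Ha; simpl; rewrite <- (Hkl _ a Ha); auto.
    rewrite A1; auto.
  - intros z Hz. destruct (Rle_or_lt z e) as [h|h].
    { exists true. rewrite EL by lra. unfold lower_end; lra. }
    destruct (Rle_or_lt (1 - e) z) as [h'|h'].
    { exists true. rewrite EU by lra. unfold upper_end; lra. }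
    destruct (Req_dec (h1 z) z) as [E|E]; [|exists true; auto].
    exists false; simpl. apply X2; auto; lra.
Qed.

(** * A relation satisfied by a dense set of pairs *)

(** Recording only the signs of the end letters suffices: letters of equal sign never cancel, so
    blocks with matching signs concatenate to reduced words. *)
Definition block (s t : bool) (w : list letter) : Prop :=
  exists a v, w = a :: v /\ reduced_from a v /\ snd a = s /\ snd (last v a) = t.

Lemma block_reduced s t w : block s t w -> reduced w.
Proof. intros (a & v & -> & H & _); exact H. Qed.

Lemma block_app r s t v w : block r s v -> block s t w -> block r t (v ++ w).
Proof.
  intros (a & v' & -> & Hv & Ha & Hl) (b & w' & -> & Hw & Hb & Hl').
  exists a, (v' ++ b :: w'); split; [reflexivity|]. split; [|split; auto].
  - apply reduced_from_app; split; auto. split; auto.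
    intros E. rewrite E in Hb. unfold linv in Hb; simpl in Hb. rewrite Hl in Hb.
    destruct s; discriminate.
  - rewrite last_app_cons; auto.
Qed.

Lemma block_winv s t w : block s t w -> block (negb t) (negb s) (winv w).
Proof.
  intros (a & v & -> & Hv & <- & <-).
  destruct (reduced_from_winv a v Hv) as (b & v' & E & -> & H).
  exists (linv (last v a)), v'. rewrite winv_cons, E. repeat split; auto.
  rewrite <- (last_cons _ (linv a)), <- E, last_last. reflexivity.
Qed.

(* Both generators agree near the endpoints, so [h = g1^-1 g2] is supported in
   [(e, 1 - e)]; a word pushing [e] above [1 - e] conjugates [h] to an element
   with disjoint support. *)
Lemma relation_exists g e : Hpair g -> no_common_fixpoint g -> 0 < e < / 2 ->
  (forall i z, 0 <= z <= e -> g i z = lower_end z) ->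
  (forall i z, 1 - e <= z <= 1 -> g i z = upper_end z) ->
  exists w, reduced w /\ forall x, run g w x = x.
Proof.
  intros Hg Hf He HL HU.
  destruct (ascending_reach g e (1 - e)) as (u0 & Hu0 & Hr0); auto; try lra.
  set (y := run g u0 e) in *.
  assert (Hy : 0 < y < 1) by (apply in_H_interior; [apply in_H_run; auto|lra]).
  (* The extra letter makes the last sign positive; it still ascends, because the generators move
     points up near 1. The first sign is negative because they move points down near 0. *)
  set (u := u0 ++ [(true, true)]).
  assert (Hup : y < act g (true, true) y).
  { unfold act; simpl. rewrite HU by lra. unfold upper_end; lra. }
  assert (Hu : ascending g u e).
  { apply ascending_app; split; auto. split; simpl; auto. }
  assert (HUe : 1 - e < run g u e) by (unfold u; rewrite run_app; simpl; fold y; lra).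
  assert (Bu : block false true u).
  { destruct u0 as [|a u1]; [unfold y in Hr0; simpl in Hr0; lra|].
    exists a, (u1 ++ [(true, true)]). repeat split.
    - eapply ascending_reduced_from; eauto.
    - destruct Hu0 as [h _]. unfold act in h. destruct (snd a); auto.
      rewrite HL in h by lra. unfold lower_end in h; lra.
    - rewrite last_last; auto. }
  set (hw := [(false, true); (true, false)]).
  assert (Bh : block true false hw).
  { exists (false, true), [(true, false)]. repeat split; discriminate. }
  set (h := run g hw).
  assert (Ih : incbij h) by (apply run_incbij; auto).
  assert (Hh : forall z, ~ e < z < 1 - e -> h z = z).
  { intros z Hz. assert (E : g true z = g false z).
    { destruct (I01_cases z) as [hz|[hz|hz]];
        try (rewrite !in_H_off; auto; apply not_I01; lra).
      unfold I01 in hz. destruct (Rle_or_lt z e); [rewrite !HL|rewrite !HU]; auto; lra. }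
    unfold h; simpl; unfold act; simpl. rewrite <- E. apply Khinv, in_H_incbij; auto. }
  assert (Hh' : forall z, e < z < 1 - e -> e < h z < 1 - e).
  { intros z Hz. split.
    - rewrite <- (Hh e) by lra. apply Ih; lra.
    - rewrite <- (Hh (1 - e)) by lra. apply Ih; lra. }
  assert (Iu : incbij (run g u)) by (apply run_incbij; auto).
  set (v := run g (winv u)).
  assert (Huv : forall x, run g u (v x) = x) by (intros; apply run_Kwinv; auto).
  set (k := fun x => run g u (h (v x))).
  assert (Hk : forall x, x <= 1 - e -> k x = x).
  { intros x Hx. unfold k. rewrite Hh, Huv; auto.
    assert (v x < e); [|lra]. apply (incbij_lt_inv (run g u)); auto. rewrite Huv; lra. }
  assert (Hcomm : forall x, h (k x) = k (h x)).
  { intros x. destruct (classic (e < x < 1 - e)) as [hx|hx].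
    - rewrite (Hk x), (Hk (h x)); auto; [apply Hh' in hx|]; lra.
    - rewrite (Hh x) by auto. destruct (classic (e < v x < 1 - e)) as [hv|hv].
      + apply Hh. assert (run g u e < k x); [|lra].
        apply Iu. apply Hh'; auto.
      + unfold k. rewrite (Hh (v x)), Huv by auto. apply Hh; auto. }
  (* The commutator of [h] and its conjugate [k], already in reduced form. *)
  exists (hw ++ (winv u ++ hw ++ u) ++ winv hw ++ (winv u ++ winv hw ++ u)). split.
  - apply (block_reduced true true).
    pose proof (block_winv _ _ _ Bu) as Bu'. pose proof (block_winv _ _ _ Bh) as Bh'.
    simpl in Bu', Bh'. rewrite <- !app_assoc.
    repeat (eapply block_app; [eassumption|]). exact Bu.
  - intros x. rewrite !run_app.
    assert (E : run g u (run g hw (run g (winv u) (run g hw x)))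
      = run g hw (run g u (run g hw (run g (winv u) x)))) by (symmetry; exact (Hcomm x)).
    rewrite E, !run_winvK by auto. apply run_Kwinv; auto.
Qed.

(** * Neighbourhoods of the identity *)

(** Both endpoints 0 and 1 are included, hence [n + 2] points. *)
Definition grid (n : nat) : list R := map (fun k => INR k / INR (S n)) (seq 0 (n + 2)).

(** On H these form a countable neighbourhood base of the identity, the source of the countable
    unions in the proof of meagerness. *)
Definition small (n : nat) (h : R -> R) : Prop :=
  forall a, In a (grid n) -> Rabs (h a - a) < / INR (S n).

Lemma grid_bracket n x : I01 x -> exists a b, In a (grid n) /\ In b (grid n) /\
  a <= x <= b /\ b <= a + / INR (S n).
Proof.
  intros [h0 h1]. assert (Hn : 0 < INR (S n)) by (apply lt_0_INR; lia).
  assert (H : forall m, x <= INR m / INR (S n) -> (m <= S n)%nat -> exists k, (k <= n)%nat /\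
    INR k / INR (S n) <= x <= INR (S k) / INR (S n)).
  { induction m as [|m IH]; intros Hm Hmn.
    - exists 0%nat. split; [lia|]. unfold Rdiv in *; rewrite Rmult_0_l in *.
      assert (0 < INR 1 * / INR (S n)); [|simpl in *; lra].
      apply Rmult_lt_0_compat; [simpl; lra|apply Rinv_0_lt_compat; auto].
    - destruct (Rle_or_lt x (INR m / INR (S n))) as [h|h]; [apply IH; auto; lia|].
      exists m; split; [lia|lra]. }
  destruct (H (S n)) as (k & Hk & Hx); [|lia|].
  { replace (INR (S n) / INR (S n)) with 1 by (field; lra). auto. }
  exists (INR k / INR (S n)), (INR (S k) / INR (S n)).
  repeat split; try apply Hx.
  - apply in_map_iff; exists k; split; auto. apply in_seq; lia.
  - apply in_map_iff; exists (S k); split; auto. apply in_seq; lia.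
  - rewrite (S_INR k). right; field; lra.
Qed.

(** Monotonicity between adjacent grid points: one [/ INR (S n)] is the error at the grid, the other
    is the mesh. *)
Lemma small_uniform n h x : in_H h -> small n h -> Rabs (h x - x) < 2 * / INR (S n).
Proof.
  intros Hh Hs. assert (Hn : 0 < / INR (S n)) by (apply Rinv_0_lt_compat, lt_0_INR; lia).
  destruct (classic (I01 x)) as [hx|hx].
  - destruct (grid_bracket n x hx) as (a & b & Ha & Hb & Hx & Hab).
    pose proof (Hs a Ha) as Sa; pose proof (Hs b Hb) as Sb. apply Rabs_def2 in Sa, Sb.
    pose proof (in_H_incbij h Hh).
    assert (h a <= h x) by (apply incbij_le; auto; lra).
    assert (h x <= h b) by (apply incbij_le; auto; lra).
    apply Rabs_def1; lra.
  - rewrite (in_H_off h), Rminus_diag, Rabs_R0; auto; lra.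
Qed.

Lemma small_basic l eps : 0 < eps ->
  exists n, forall h, in_H h -> small n h -> basic (fun x => x) l eps h.
Proof.
  intros He. destruct (archimed_cor1 (eps / 2)) as (N & HN & HN0); [lra|].
  exists (pred N). intros h Hh Hs; split; auto. intros a _.
  pose proof (small_uniform _ h a Hh Hs) as Ha.
  replace (S (pred N)) with N in Ha by lia. lra.
Qed.

(** If [w] nearly fixes the image of [x] under [u], continuity of the inverse of [u] finishes. A
    finite list of conjugators is treated at once because the conjugator will be chosen after
    [w]. *)
Lemma conjugate_small f us pts eps : Hpair f -> 0 < eps ->
  exists l d, 0 < d /\ forall w, (forall x, In x l -> Rabs (run f w x - x) < d) ->
    forall u x, In u us -> In x pts -> Rabs (run f (u ++ w ++ winv u) x - x) < eps.
Proof.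
  intros Hf He.
  assert (H : forall ps : list (list letter * R), exists l d, 0 < d /\
    forall w, (forall x, In x l -> Rabs (run f w x - x) < d) ->
      forall u x, In (u, x) ps -> Rabs (run f (u ++ w ++ winv u) x - x) < eps).
  { induction ps as [|[u x] ps (l & d & Hd & H)].
    { exists [], 1; split; [lra|simpl; tauto]. }
    destruct (incbij_continuous (run f (winv u)) (run f u x) eps) as (d' & Hd' & H');
      auto using run_incbij.
    exists (run f u x :: l), (Rmin d d'); split; [apply Rmin_pos; auto|].
    pose proof (Rmin_l d d'); pose proof (Rmin_r d d').
    intros w Hw v z [E|Hz].
    - injection E as <- <-. rewrite !run_app. rewrite <- (run_winvK f u x) at 2 by auto.
      apply H'. eapply Rlt_le_trans; [apply Hw; left; auto|]; auto.
    - apply H; auto. intros a Ha. eapply Rlt_le_trans; [apply Hw; right; auto|]; auto. }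
  destruct (H (list_prod us pts)) as (l & d & Hd & Hl).
  exists l, d; split; auto. intros w Hw u x Hu Hx.
  apply Hl; auto. apply in_prod; auto.
Qed.

(** * Topological similarity *)

Lemma gen_in_H f1 f2 h : in_H f1 -> in_H f2 -> gen f1 f2 h -> in_H h.
Proof.
  intros H1 H2; induction 1; auto using in_H_id, in_H_comp.
  eapply in_H_inverse; eauto.
Qed.

Lemma gen_act g a : Hpair g -> gen (g true) (g false) (act g a).
Proof.
  intros Hg. assert (H : forall i, gen (g true) (g false) (g i)) by (intros []; constructor).
  unfold act; destruct (snd a); auto.
  apply (gen_inv _ _ (g (fst a))); auto; intros; [apply Khinv|apply hinvK];
    apply in_H_incbij; auto.
Qed.

Lemma gen_run g w : Hpair g -> gen (g true) (g false) (run g w).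
Proof.
  intros Hg; induction w as [|a w IH]; [apply gen_id|].
  exact (gen_comp _ _ _ _ IH (gen_act g a Hg)).
Qed.

(** Multiplicativity makes the image of the identity idempotent, hence the identity; inverses, and
    then all words, follow. *)
Lemma similar_run g f phi : Hpair g -> Hpair f ->
  (forall x, gen (g true) (g false) x -> gen (f true) (f false) (phi x)) ->
  (forall x y, gen (g true) (g false) x -> gen (g true) (g false) y ->
    phi (fun t => x (y t)) = (fun t => phi x (phi y t))) ->
  (forall i, phi (g i) = f i) ->
  forall w, phi (run g w) = run f w.
Proof.
  intros Hg Hf Hm Hmul Hgen.
  assert (Hid : phi (fun x => x) = (fun x => x)).
  { pose proof (gen_id (g true) (g false)) as Gid.
    pose proof (Hmul _ _ Gid Gid) as E. simpl in E.
    apply functional_extensionality; intros t.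
    apply (incbij_inj (phi (fun x => x))).
    - apply in_H_incbij, (gen_in_H (f true) (f false)); auto.
    - symmetry. exact (f_equal (fun k => k t) E). }
  assert (Hact : forall a, phi (act g a) = act f a).
  { intros [i s]; unfold act; simpl; destruct s; auto.
    assert (Gi : gen (g true) (g false) (g i)) by exact (gen_act g (i, true) Hg).
    assert (Gi' : gen (g true) (g false) (hinv (g i))) by exact (gen_act g (i, false) Hg).
    pose proof (Hmul _ _ Gi Gi') as E.
    replace (fun t => g i (hinv (g i) t)) with (fun t : R => t) in E
      by (apply functional_extensionality; intros; rewrite hinvK; auto using in_H_incbij).
    rewrite Hid, Hgen in E. apply functional_extensionality; intros t.
    apply (incbij_inj (f i)); [apply in_H_incbij; auto|].
    rewrite hinvK by auto using in_H_incbij. symmetry; exact (f_equal (fun k => k t) E). }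
  induction w as [|a w IH]; [exact Hid|].
  transitivity (fun t => phi (run g w) (phi (act g a) t)).
  - exact (Hmul _ _ (gen_run g w Hg) (gen_act g a Hg)).
  - rewrite IH, Hact; reflexivity.
Qed.

Lemma pair_of_eta g : pair_of (g true) (g false) = g.
Proof. apply functional_extensionality; intros []; reflexivity. Qed.

(** * Countable covers of a similarity class by nowhere dense sets *)

Definition half_almost_fixed (f : bool -> R -> R) (n : nat) : H2Set := fun a b =>
  forall w, small n (run f w) -> Rabs (run (pair_of a b) w (1 / 2) - 1 / 2) < 1 / 4.

Definition word_discrete (n : nat) : H2Set := fun a b =>
  forall w, reduced w -> ~ small n (run (pair_of a b) w).

(** This is continuity of the inverse of [phi] at the identity: the image of the neighbourhood given
    by 1/2 and 1/4 is relatively open in the group generated by [f], and injectivity of [phi] pulls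
    the estimate back to the word in [g]. *)
Lemma similar_half_almost_fixed f g : Hpair f -> Hpair g ->
  top_similar (g true) (g false) (f true) (f false) ->
  exists n, half_almost_fixed f n (g true) (g false).
Proof.
  intros Hf Hg (phi & Hm & Hinj & _ & Hmul & E1 & E2 & _ & Hop).
  assert (Hrun := similar_run g f phi Hg Hf Hm Hmul).
  specialize (Hrun ltac:(intros []; auto)).
  destruct (Hop (basic (fun x => x) [1 / 2] (1 / 4))) as (O & [_ HO] & HOeq).
  { apply basic_open. intros a [<-|[]]; unfold I01; lra. }
  assert (Oid : O (fun x => x)).
  { apply HOeq; [apply gen_id|]. exists (fun x => x); split; [apply gen_id|split].
    - split; [apply in_H_id|]. intros; rewrite Rminus_diag, Rabs_R0; lra.
    - exact (Hrun []). }
  destruct (HO _ Oid) as (l & eps & [_ He] & Hl).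
  destruct (small_basic l eps He) as (n & Hn).
  exists n. intros w Hw. rewrite pair_of_eta.
  destruct (proj2 (HOeq (run f w) (gen_run f w Hf))) as (x & Gx & [_ Hx] & Ex).
  { apply Hl, Hn; auto using in_H_run. }
  rewrite <- Hrun in Ex. apply Hinj in Ex; auto using gen_run. subst x.
  apply Hx; left; auto.
Qed.

(** This is continuity of [phi] at the identity: a word too small at [g] would be small at [f]. *)
Lemma similar_word_discrete f g l eps : Hpair f -> Hpair g ->
  (forall a, In a l -> I01 a) -> 0 < eps ->
  (forall w, reduced w -> ~ basic (fun x => x) l eps (run f w)) ->
  top_similar (g true) (g false) (f true) (f false) ->
  exists n, word_discrete n (g true) (g false).
Proof.
  intros Hf Hg Hl He Hd (phi & Hm & Hinj & _ & Hmul & E1 & E2 & Hop & _).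
  assert (Hrun := similar_run g f phi Hg Hf Hm Hmul).
  specialize (Hrun ltac:(intros []; auto)).
  destruct (Hop (basic (fun x => x) l eps)) as (O & [_ HO] & HOeq); [apply basic_open; auto|].
  assert (Oid : O (fun x => x)).
  { apply HOeq; [apply gen_id|]. change (fun x : R => x) with (run g []).
    rewrite Hrun. split; [apply in_H_id|].
    intros; simpl; rewrite Rminus_diag, Rabs_R0; lra. }
  destruct (HO _ Oid) as (l' & eps' & [_ He'] & Hl').
  destruct (small_basic l' eps' He') as (n & Hn).
  exists n. intros w Hw Hs. rewrite pair_of_eta in Hs. apply (Hd w Hw).
  rewrite <- Hrun. apply HOeq; auto using gen_run. apply Hl', Hn; auto using in_H_run.
Qed.

Lemma letter_avoiding (a b c : letter) : exists d, d <> a /\ d <> b /\ d <> c.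
Proof.
  destruct a as [[] []], b as [[] []], c as [[] []];
    first [exists (true, true); repeat split; discriminate
          |exists (true, false); repeat split; discriminate
          |exists (false, true); repeat split; discriminate
          |exists (false, false); repeat split; discriminate].
Qed.

Lemma half_almost_fixed_nowhere_dense f n : Hpair f ->
  (forall l eps, 0 < eps ->
    exists w, reduced w /\ forall x, In x l -> Rabs (run f w x - x) < eps) ->
  H2_nowhere_dense (half_almost_fixed f n).
Proof.
  intros Hf Hnd. apply nowhere_dense_intro. intros g l eps Hg He.
  destruct (good_pair_dense g l eps Hg He) as (k & _ & Hk & Hkn & Hfix & _).
  destruct (escape k l Hk Hfix) as (u & a & Hred & Hesc).
  (* All four candidates for [b] are listed, since [b] depends on [w], which is chosen later. *)
  set (conjs := map (fun b => u ++ [a; b])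
    [(true, true); (true, false); (false, true); (false, false)]).
  assert (Hn : 0 < / INR (S n)) by (apply Rinv_0_lt_compat, lt_0_INR; lia).
  destruct (conjugate_small f conjs (grid n) (/ INR (S n)) Hf Hn) as (l' & d & Hd & Hconj).
  destruct (Hnd l' d Hd) as (w & Hw & Hwf).
  destruct w as [|c w]; [destruct Hw|]. simpl in Hw.
  (* The exclusions prevent cancellation between [a] and [b], between [b] and the first letter [c],
     and between the last letter of [c :: w] and the inverse of [b]. *)
  destruct (letter_avoiding (linv a) (linv c) (last w c)) as (b & Hb1 & Hb2 & Hb3).
  set (v := (u ++ [a; b]) ++ (c :: w) ++ winv (u ++ [a; b])).
  assert (Hv : small n (run f v)).
  { intros x Hx. apply Hconj; auto. apply in_map_iff; exists b; split; auto.
    destruct b as [[] []]; simpl; auto. }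
  assert (Ev : v = u ++ a :: (b :: (c :: w) ++ linv b :: winv (u ++ [a]))).
  { unfold v. replace (u ++ [a; b]) with ((u ++ [a]) ++ [b]) by (rewrite <- app_assoc; auto).
    rewrite winv_snoc. rewrite <- !app_assoc. reflexivity. }
  destruct (Hesc (b :: (c :: w) ++ linv b :: winv (u ++ [a]))) as (k' & Hk' & Hag & Hrun).
  { split; auto. apply reduced_from_app. split.
    - split; auto. intros E; apply Hb2. rewrite E, linvK; auto.
    - rewrite last_cons. split.
      + intros E; apply Hb3. rewrite <- (linvK b), E, linvK; auto.
      + destruct (u ++ [a]) as [|a' u'] eqn:E; [destruct u; discriminate|]. simpl in Hred.
        destruct (reduced_from_winv a' u' Hred) as (b' & v' & E' & -> & Hv').
        rewrite winv_cons, E'. split; auto.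
        assert (last u' a' = a) as ->.
        { rewrite <- (last_cons a' a'), <- E. apply last_last. }
        rewrite linvK. congruence. }
  rewrite <- Ev in Hrun. exists k'; split; [auto|split].
  - intros i x Hx. rewrite Hag by auto. auto.
  (* Nearby pairs still send 1/2 above 3/4, although [v] evaluated at [f] is [small n]. *)
  - destruct (run_continuous k' v [1 / 2] (run k' v (1 / 2) - 3 / 4) Hk')
      as (m & e & He' & Hm); [lra|].
    exists m, e; split; auto. intros h Hh Hnear HA.
    specialize (HA v Hv). rewrite pair_of_eta in HA.
    specialize (Hm h Hh Hnear (1 / 2) (or_introl eq_refl)).
    apply Rabs_def2 in HA, Hm. lra.
Qed.

Lemma word_discrete_nowhere_dense n : H2_nowhere_dense (word_discrete n).
Proof.
  apply nowhere_dense_intro. intros g l eps Hg He.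
  destruct (good_pair_dense g l eps Hg He) as (k & e & Hk & Hkn & Hfix & He' & HL & HU).
  destruct (relation_exists k e Hk Hfix He' HL HU) as (w & Hw & Hrel).
  exists k; split; [auto|split; auto].
  assert (Hn : 0 < / INR (S n)) by (apply Rinv_0_lt_compat, lt_0_INR; lia).
  (* The relation holds exactly at [k], so at nearby pairs [w] is [small n]. *)
  destruct (run_continuous k w (grid n) _ Hk Hn) as (m & d & Hd & Hm).
  exists m, d; split; auto. intros h Hh Hnear HA. apply (HA w Hw).
  rewrite pair_of_eta. intros x Hx. rewrite <- (Hrel x) at 2. apply Hm; auto.
Qed.

Theorem theorem3p14 : forall f1 f2 : R -> R,
  in_H f1 -> in_H f2 -> H2_meager (sim_class f1 f2).
Proof.
  intros f1 f2 H1 H2.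
  assert (Hp : forall a b, in_H a -> in_H b -> Hpair (pair_of a b)) by (intros a b ? ? []; auto).
  set (f := pair_of f1 f2). assert (Hf : Hpair f) by (apply Hp; auto).
  (* Either nonempty reduced words evaluated at [f] accumulate at the identity, or they avoid a
     neighbourhood of it. *)
  destruct (classic (forall l eps, 0 < eps ->
    exists w, reduced w /\ forall x, In x l -> Rabs (run f w x - x) < eps)) as [Hnd|Hd].
  - exists (half_almost_fixed f); split; [intros n; apply half_almost_fixed_nowhere_dense; auto|].
    intros a b (Ha & Hb & Hs).
    exact (similar_half_almost_fixed f (pair_of a b) Hf (Hp a b Ha Hb) Hs).
  - exists word_discrete; split; [apply word_discrete_nowhere_dense|].
    intros a b (Ha & Hb & Hs).
    apply not_all_ex_not in Hd; destruct Hd as [l Hd].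
    apply not_all_ex_not in Hd; destruct Hd as [eps Hd].
    apply imply_to_and in Hd; destruct Hd as [He Hd].
    destruct (restrict_I01 l) as (l' & Hl' & Hr).
    apply (similar_word_discrete f (pair_of a b) l' eps); auto.
    intros w Hw [_ Hb']. apply Hd. exists w; split; auto.
    apply (Hr (fun x => x) (run f w)); auto using in_H_id, in_H_run.
Qed.
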